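(* For every index $\boldsymbol{k}$ and every regularization parameter $T\in\mathbb C$, $$\mathcal T_*^T(\boldsymbol{k};s+1)=\mathcal T_*^T(\boldsymbol{k};s)\qquad\text{for all } s\in\mathbb C\setminus\mathbb Z.$$
   Context: An index is a finite sequence $\boldsymbol{k}=(k_1,\dots,k_r)$ of positive integers, of depth $r$ and weight $|\boldsymbol{k}|=k_1+\cdots+k_r$; the empty index is $\varnothing$ (weight $0$). Reversal: $\overleftarrow{\boldsymbol{k}}=(k_r,\dots,k_1)$. Write $\boldsymbol{k}_{[1,j]}=(k_1,\dots,k_j)$, $\boldsymbol{k}_{(j,r]}=(k_{j+1},\dots,k_r)$, $\boldsymbol{k}_{[1,j)}=(k_1,\dots,k_{j-1})$, with $\boldsymbol{k}_{[1,0]}=\boldsymbol{k}_{(r,r]}=\boldsymbol{k}_{[1,1)}=\varnothing$. An index is admissible if it is empty or its last entry is $\geqslant2$. Stuffle regularization. For a nonempty admissible index $\boldsymbol{a}=(a_1,\dots,a_d)$, $\zeta(\boldsymbol{a};s)=\sum_{0<n_1<\cdots<n_d}\prod_{i}(n_i+s)^{-a_i}$, and $\zeta(\varnothing;s)=1$. On the $\mathbb Q$-span $\mathfrak H^1_*$ of all indices, the stuffle product $*$ is bilinear with unit $\varnothing$ and $(a,\boldsymbol{\alpha})*(b,\boldsymbol{\beta})=(a,\boldsymbol{\alpha}*(b,\boldsymbol{\beta}))+(b,(a,\boldsymbol{\alpha})*\boldsymbol{\beta})+(a+b,\boldsymbol{\alpha}*\boldsymbol{\beta})$; $\mathfrak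 H^0_*$ is the span of admissible indices. It is known that every index of depth $r$ has a unique decomposition $\boldsymbol{k}=\sum_{l=0}^r\boldsymbol{u}_l*(1)^{*l}$ with $\boldsymbol{u}_l\in\mathfrak H^0_*$. Define $\zeta_*^X(\boldsymbol{k};s)=\sum_{l=0}^r\zeta(\boldsymbol{u}_l;s)X^l$ (with $\zeta(\cdot;s)$ extended linearly); equivalently, $\zeta_*^X(\cdot;s)$ is the unique stuffle homomorphism extending $\zeta(\cdot;s)$ on admissible indices with $\zeta_*^X(1;s)=X$. Harmonic number function: $H(s)=\int_0^1\frac{1-t^s}{1-t}\,dt=\psi(1+s)+\gamma=\sum_{n\geqslant1}\bigl(\frac1n-\frac1{n+s}\bigr)$, extended meromorphically to $\mathbb C$. Regularized multitangent function (a meromorphic function of $s\in\mathbb C$): $$\mathcal T_*^T(\boldsymbol{k};s)=\sum_{j=0}^{r}(-1)^{|\boldsymbol{k}_{[1,j]}|}\zeta_*^{T-H(-s)}(\overleftarrow{\boldsymbol{k}_{[1,j]}};-s)\,\zeta_*^{T-H(s)}(\boldsymbol{k}_{(j,r]};s)+\sum_{j=1}^{r}\frac{(-1)^{|\boldsymbol{k}_{[1,j)}|}}{s^{k_j}}\zeta_*^{T-H(-s)}(\overleftarrow{\boldsymbol{k}_{[1,j)}};-s)\,\zeta_*^{T-H(s)}(\boldsymbol{k}_{(j,r]};s),$$ with empty-index factors equal to $1$. *)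

(* Defs.v *)
From mathcomp Require Import all_boot all_order all_algebra.
From mathcomp Require Import all_classical all_reals all_analysis.
From mathcomp Require Import complex freeg.

Set Implicit Arguments.
Unset Strict Implicit.
Unset Printing Implicit Defensive.

Import Order.TTheory GRing.Theory Num.Theory.
Import numFieldNormedType.Exports.

Local Open Scope classical_set_scope.
Local Open Scope complex_scope.
Local Open Scope ring_scope.

(* Indices are sequences of natural numbers all of whose entries are
   positive; the depth is [size] and the weight is [sumn].                *)
Definition is_index (k : seq nat) : bool := all (leq 1) k.

Definition admissible (k : seq nat) : bool :=
  is_index k && ((k == [::]) || (2 <= last 0 k)%N).

(* The ambient Q-vector space of formal combinations; H^1_* is its subspace
   spanned by the sequences satisfying [is_index].                        *)
Notation formal := {freeg (seq nat) / rat}.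

Definition inH0 (u : formal) : bool := all admissible (dom u).

(* Linear extension of (alpha_1, ...) |-> (a, alpha_1, ...). *)
Definition consH (a : nat) (u : formal) : formal :=
  fglift (fun alpha : seq nat => << a :: alpha >> : formal) u.

Fixpoint stuffle_idx (k : seq nat) : seq nat -> formal :=
  if k is a :: alpha then
    fix stuffle_k (l : seq nat) : formal :=
      if l is b :: beta then
        consH a (stuffle_idx alpha (b :: beta))
        + consH b (stuffle_k beta)
        + consH (a + b)%N (stuffle_idx alpha beta)
      else << a :: alpha >>
  else fun l => << l >>.

Definition stuffle (u v : formal) : formal :=
  fglift (fun k => fglift (fun l => stuffle_idx k l) v) u.

(* (1)^{*l} *)
Definition stuffle_pow1 (l : nat) : formal :=
  iter l (stuffle << [:: 1%N] >>) << [::] >>.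

Definition is_reg_decomp (k : seq nat)
    (u : {ffun 'I_(size k).+1 -> formal}) : Prop :=
  (forall l, inH0 (u l)) /\
  (<< k >> : formal) = \sum_l stuffle (u l) (stuffle_pow1 l).

(* The decomposition of k, which exists and is unique for every index k;
   [xget] returns the default value 0 only if there is none.               *)
Definition reg_decomp (k : seq nat) : {ffun 'I_(size k).+1 -> formal} :=
  xget [ffun=> 0] [set u | is_reg_decomp u].

Section Multitangent.
Variable R : realType.
Implicit Types (s X T : R[i]) (a k : seq nat).

(* The limit of the partial sums over 0 < n_1 < ... < n_d <= N; the multiple
   series converges absolutely for a admissible and s not a negative integer,
   and the value is 1 for the empty index.                                 *)
Definition zeta_trunc (a : seq nat) (s : R[i]) (N : nat) : R[i] :=
  \sum_(n : (size a).-tuple 'I_N.+1 | path ltn 0 [seq val m | m <- n])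
    \prod_(i < size a) ((tnth n i)%:R + s) ^- nth 0%N a i.

Definition zeta (a : seq nat) (s : R[i]) : R[i] :=
  lim ((zeta_trunc a s : nat -> (R[i])^o) @ \oo).

Definition zeta_lin (u : formal) (s : R[i]) : R[i] :=
  \sum_(a <- dom u) ratr (coeff a u) * zeta a s.

Definition zeta_reg (X : R[i]) (k : seq nat) (s : R[i]) : R[i] :=
  \sum_(l < (size k).+1) zeta_lin (reg_decomp k l) s * X ^+ l.

Definition harmonic_trunc (s : R[i]) (N : nat) : R[i] :=
  \sum_(1 <= n < N.+1) (n%:R^-1 - (n%:R + s)^-1).

Definition harmonicH (s : R[i]) : R[i] :=
  lim ((harmonic_trunc s : nat -> (R[i])^o) @ \oo).

(* The second sum is indexed from 0: its j-th term involves the entry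
   k_{j+1} = nth 0 k j, the entries before it and the entries after it.     *)
Definition multitangent_reg (T : R[i]) (k : seq nat) (s : R[i]) : R[i] :=
  \sum_(j < (size k).+1)
     (-1) ^+ sumn (take j k)
     * zeta_reg (T - harmonicH (- s)) (rev (take j k)) (- s)
     * zeta_reg (T - harmonicH s) (drop j k) s
  + \sum_(j < size k)
     (-1) ^+ sumn (take j k) / s ^+ nth 0%N k j
     * zeta_reg (T - harmonicH (- s)) (rev (take j k)) (- s)
     * zeta_reg (T - harmonicH s) (drop j.+1 k) s.

End Multitangent.

(* Main.v *)
From HB Require Import structures.
Require Import Defs.
From mathcomp Require Import all_boot all_order all_algebra.
From mathcomp Require Import all_classical all_reals all_analysis.
From mathcomp Require Import complex freeg ring lra zify.

(** Write Z_k(s) for the stuffle-regularized value of k at s with parameter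
T - H(s).  Everything follows from the shift relation
  Z_(a, k)(s) = Z_(a, k)(s + 1) + (s + 1)^(-a) Z_k(s + 1),
[zeta_star_shift].  Used at s for the right-hand factors of the multitangent
sums, it absorbs the second sum of the value at s + 1 into the first; used at
- (s + 1) for the reversed left-hand factors, it does the same to the value at
s.  Both values become the same sum, with left factors at - (s + 1) and right
factors at s.

The shift relation is obvious for the truncated series: the sum over
0 < n_1 < ... < n_r <= N is the monomial quasi-symmetric polynomial of k
evaluated at the inverses of 1 + s, ..., N + s ([zeta_truncE]), and separating
the terms with n_1 = 1 is its recursive definition.  To pass to regularized
values, fix a decomposition k = sum_l u_l * (1)^l with admissible u_l.
Quasi-symmetric polynomials multiply by the stuffle rule ([qsymM]), and the
truncation of (1) is h_N - (H(s) truncated at N), where h_N is the harmonic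
number; so the truncation of k differs from P_(k,s)(h_N), where P_(k,s)(T) is
Z_k(s) seen as a polynomial in T, by an error which tends to zero faster than
every power of h_N ([small_zeta_poly]).  This speed matters, because
convergence errors get multiplied by powers of h_N; it holds because they are
O(N^(-1/2)) while powers of h_N are O(N^(1/2)) ([harmonic_growth],
[small_telescope]).  Hence the two sides of the shift relation are polynomials
in T whose values at h_N differ by a null sequence.  As h_N is unbounded, the
polynomials coincide ([small_poly_harmonic]), which gives the relation for
every T.

The existence of a decomposition for every index ([reg_decompP]) is proved by
induction on the number t of trailing ones: (g, 1^t) * (1) equals
(t + 1) (g, 1^(t+1)) plus indices with at most t trailing ones, and
associativity of the stuffle product turns a decomposition of (g, 1^t) into
one of (g, 1^t) * (1). *)

Set Implicit Arguments.
Unset Strict Implicit.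
Unset Printing Implicit Defensive.

Import Order.TTheory GRing.Theory Num.Theory.
Import numFieldNormedType.Exports.
Import ComplexField.Normc.

Local Open Scope classical_set_scope.
Local Open Scope complex_scope.
Local Open Scope ring_scope.

(** * The stuffle product *)

Lemma freegUZ (c : rat) (k : seq nat) : << c *g k >> = c *: (<< k >> : formal).
Proof.
by apply/eqP/freeg_eqP => x; rewrite coeffZ !coeffU mul1r.
Qed.

Lemma formal_ind (P : formal -> Prop) :
  P 0 -> (forall c k u, P u -> P (c *: << k >> + u)) -> forall u, P u.
Proof.
move=> P0 PS u; elim/freeg_ind_dom0: u => [//|c k u _ _ Pu].
by rewrite freegUZ; apply: PS.
Qed.

Section Lift.
Variables (V : lmodType rat) (f : seq nat -> V).

Lemma fglift_basis k : fglift f << k >> = f k.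
Proof. by rewrite liftU scale1r. Qed.

Lemma fglift_is_linear : linear (fglift f).
Proof.
have liftB : {morph fglift f : u v / u - v} by apply: lift_is_additive.
have lift0 : fglift f 0 = 0 by rewrite -(subrr 0) liftB subrr.
have liftD : {morph fglift f : u v / u + v}.
  by move=> u v; rewrite -{1}[v]opprK -[- v]add0r !liftB lift0 sub0r opprK.
move=> c u v; rewrite liftD; congr (_ + _).
elim/formal_ind: u => [|d k u IHu]; first by rewrite !(scaler0, lift0).
by rewrite scalerDr !liftD IHu scalerA -!freegUZ !liftU scalerDr scalerA.
Qed.

HB.instance Definition _ :=
  GRing.isLinear.Build rat formal V *:%R (fglift f) fglift_is_linear.
End Lift.

HB.instance Definition _ a :=
  GRing.Linear.copy (consH a) (fglift (fun k : seq nat => << a :: k >> : formal)).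

Lemma consHU a k : consH a << k >> = << a :: k >>.
Proof. exact: fglift_basis. Qed.

Lemma stuffleUU k l : stuffle << k >> << l >> = stuffle_idx k l.
Proof. by rewrite /stuffle !fglift_basis. Qed.

Lemma stuffle_is_linear u : linear (stuffle u).
Proof.
elim/formal_ind: u => [|c k u IHu] d v w.
  by rewrite /stuffle !linear0 addr0.
have E x : stuffle (c *: << k >> + u) x
    = c *: fglift (stuffle_idx k) x + stuffle u x.
  by rewrite /stuffle linearP /= fglift_basis.
by rewrite !E IHu linearP !scalerDr !scalerA [c * d]mulrC addrACA.
Qed.

HB.instance Definition _ u :=
  GRing.isLinear.Build rat formal formal *:%R (stuffle u) (stuffle_is_linear u).

Lemma stuffle_linear_l v : linear (stuffle^~ v).
Proof. by move=> c u u'; rewrite /stuffle linearP. Qed.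

Lemma stuffleDl u u' v : stuffle (u + u') v = stuffle u v + stuffle u' v.
Proof. by have := stuffle_linear_l v 1 u u'; rewrite !scale1r. Qed.

Lemma stuffle0l v : stuffle 0 v = 0.
Proof. by rewrite /stuffle raddf0. Qed.

Lemma stuffleZl c u v : stuffle (c *: u) v = c *: stuffle u v.
Proof.
by have := stuffle_linear_l v c u 0; rewrite stuffle0l !addr0.
Qed.

Lemma stuffle_suml (I : Type) (r : seq I) (F : I -> formal) v :
  stuffle (\sum_(i <- r) F i) v = \sum_(i <- r) stuffle (F i) v.
Proof.
by apply: (big_morph (stuffle^~ v)) => [u u'|]; rewrite ?stuffleDl ?stuffle0l.
Qed.

Lemma stuffle1l u : stuffle << [::] >> u = u.
Proof.
elim/formal_ind: u => [|c k u IHu]; first by rewrite raddf0.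
by rewrite linearP /= IHu stuffleUU.
Qed.

Lemma stuffle1r u : stuffle u << [::] >> = u.
Proof.
elim/formal_ind: u => [|c k u IHu]; first by rewrite stuffle0l.
by rewrite stuffleDl stuffleZl IHu stuffleUU; case: k.
Qed.

(** Stated for formal sums because the inductions on words below meet products
of words by products of words. *)
Lemma stuffle_cons a b u v :
  stuffle (consH a u) (consH b v) =
    consH a (stuffle u (consH b v)) + consH b (stuffle (consH a u) v)
    + consH (a + b) (stuffle u v).
Proof.
elim/formal_ind: u => [|c k u IHu].
  by rewrite !raddf0 !stuffle0l !raddf0 !addr0.
rewrite !linearP /= !stuffleDl !stuffleZl IHu !linearP /=.
rewrite [X in _ = X + _]addrACA [RHS]addrACA -!scalerDr; congr (_ *: _ + _) => {u IHu}.
elim/formal_ind: v => [|d l v IHv]; first by rewrite !raddf0 !addr0.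
rewrite !linearP /= ?linearP /= IHv [X in _ = X + _]addrACA [RHS]addrACA -!scalerDr.
by congr (_ *: _ + _); rewrite !consHU !stuffleUU.
Qed.

Lemma stuffleC u v : stuffle u v = stuffle v u.
Proof.
elim/formal_ind: u => [|c k u IHu]; first by rewrite stuffle0l raddf0.
rewrite stuffleDl stuffleZl linearP /= IHu; congr (_ *: _ + _) => {u c IHu}.
elim/formal_ind: v => [|c l v IHv]; first by rewrite stuffle0l raddf0.
rewrite linearP /= stuffleDl stuffleZl IHv; congr (_ *: _ + _) => {v c IHv}.
elim: k l => [|a k IHk] l; first by rewrite stuffle1l stuffle1r.
elim: l => [|b l IHl]; first by rewrite stuffle1l stuffle1r.
rewrite -!consHU !stuffle_cons !consHU !IHk IHl addnC.
by rewrite [X in X + _]addrC.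
Qed.

(** On words a :: k, b :: l, c :: m, both sides expand, by induction, into the
same seven terms, according to which of the letters a, b, c are merged into
the first letter of the result. *)
Lemma stuffleA u v w : stuffle u (stuffle v w) = stuffle (stuffle u v) w.
Proof.
elim/formal_ind: u => [|c k u IHu]; first by rewrite !stuffle0l.
rewrite !(stuffleDl, stuffleZl) IHu; congr (_ *: _ + _) => {u c IHu}.
elim/formal_ind: v => [|c l v IHv].
  by rewrite stuffle0l raddf0 stuffle0l.
rewrite !(stuffleDl, stuffleZl) !linearP /= !(stuffleDl, stuffleZl) IHv.
congr (_ *: _ + _) => {v c IHv}.
elim/formal_ind: w => [|c m w IHw]; first by rewrite !raddf0.
rewrite !linearP /= ?linearP /= IHw; congr (_ *: _ + _) => {w c IHw}.
elim: k l m => [|a k IHk] l m; first by rewrite !stuffle1l.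
elim: l m => [|b l IHl] m; first by rewrite stuffle1l stuffle1r.
elim: m => [|c m IHm]; first by rewrite !stuffle1r.
have -> : stuffle << b :: l >> << c :: m >> = consH b (stuffle << l >> << c :: m >>)
    + consH c (stuffle << b :: l >> << m >>) + consH (b + c) (stuffle << l >> << m >>).
  by rewrite -!consHU stuffle_cons.
have E : stuffle << a :: k >> << b :: l >> = consH a (stuffle << k >> << b :: l >>)
    + consH b (stuffle << a :: k >> << l >>) + consH (a + b) (stuffle << k >> << l >>).
  by rewrite -!consHU stuffle_cons.
rewrite !raddfD /= -!(consHU a k) !stuffle_cons !consHU.
rewrite -(consHU c m) E !stuffleDl !stuffle_cons !consHU.
have {}E : consH c (stuffle << a :: k >> (stuffle << b :: l >> << m >>)) =
  consH c (stuffle (consH a (stuffle << k >> << b :: l >>)) << m >>) + 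
  consH c (stuffle (consH b (stuffle << a :: k >> << l >>)) << m >>) +
  consH c (stuffle (consH (a + b) (stuffle << k >> << l >>)) << m >>).
  by rewrite IHm E !stuffleDl !raddfD.
have Ea : consH a (stuffle (stuffle << k >> << b :: l >>) << c :: m >>) =
    consH a (stuffle << k >> (consH b (stuffle << l >> << c :: m >>)))
    + consH a (stuffle << k >> (consH c (stuffle << b :: l >> << m >>)))
    + consH a (stuffle << k >> (consH (b + c) (stuffle << l >> << m >>))).
  by rewrite -IHk -(consHU b l) -(consHU c m) stuffle_cons !consHU !raddfD.
rewrite E Ea !IHl !IHk addnA.
by rewrite [LHS](AC (3*((1*3)*1)*3) ((1*4*9)*5*8*(2*6*10)*(3*7*11))).
Qed.

(** * Existence of the decomposition over admissible indices *)

(** The formal sums of words satisfying P, presented inductively so that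
closure properties propagate through linear maps. *)
Inductive span (P : seq nat -> Prop) : formal -> Prop :=
| span_zero : span P 0
| span_step c k u : P k -> span P u -> span P (c *: << k >> + u).

Lemma span_basis P k : P k -> span P << k >>.
Proof.
move=> Pk; rewrite -[<< k >>]addr0 -[<< k >>]scale1r.
by apply: span_step => //; apply: span_zero.
Qed.

Lemma spanD P u v : span P u -> span P v -> span P (u + v).
Proof.
move=> Pu Pv; elim: Pu => [|c k {}u Pk _ IHu]; first by rewrite add0r.
by rewrite -addrA; apply: span_step.
Qed.

Lemma span_consH (P Q : seq nat -> Prop) a u :
  (forall k, P k -> Q (a :: k)) -> span P u -> span Q (consH a u).
Proof.
move=> PQ; elim=> [|c k v Pk _ IHv]; first by rewrite raddf0; apply: span_zero.
by rewrite linearP /= consHU; apply: span_step => //; apply: PQ.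
Qed.

(** Nonemptiness of g rules out the words made only of ones, for which
prepending a letter 1 would increase the number of trailing ones. *)
Definition few_ones (t n : nat) (k : seq nat) : Prop :=
  exists g i, [/\ admissible g /\ g <> [::], (i <= t)%N,
    k = g ++ nseq i 1%N & (size k <= n)%N].

Lemma admissible_cons b g :
  (0 < b)%N -> admissible g -> (g = [::] -> 2 <= b)%N -> admissible (b :: g).
Proof.
rewrite /admissible /= => -> /andP [-> /=].
by case: g => [_ -> //|c g /=].
Qed.

Lemma admissible_behead b g : admissible (b :: g) -> admissible g.
Proof.
by case: g => // c g /=; rewrite /admissible /= => /andP [/andP [_ ->]] ->.
Qed.

Lemma stuffle_cons_one a u :
  stuffle (consH a u) << [:: 1%N] >> =
    consH a (stuffle u << [:: 1%N] >>) + consH 1 (consH a u) + consH a.+1 u.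
Proof. by rewrite -[<< [:: 1%N] >>]consHU stuffle_cons !stuffle1r addn1. Qed.

(** The coefficient t + 1 counts the ways to insert a 1 into the final run of
ones; inserting it further left, or adding it to a letter, cannot lengthen
that run. *)
Lemma stuffle_trailing_ones g t : admissible g ->
  exists2 e, span (few_ones t (size g + t).+1) e &
    stuffle << g ++ nseq t 1%N >> << [:: 1%N] >> =
      t.+1%:R *: << g ++ nseq t.+1 1%N >> + e.
Proof.
elim: g => [_|b g IHg adm].
  elim: t => [|t [e span_e IHt]].
    by exists 0; [exact: span_zero | rewrite stuffle1l scale1r addr0].
  exists (consH 1 e + << 2%N :: nseq t 1%N >>).
    apply: spanD.
      apply: span_consH span_e => k [g [i [[adm g0] it -> sz]]].
      exists (1%N :: g), i; split=> //; last exact: leqW.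
      by split=> //; exact: admissible_cons.
    apply: span_basis; exists [:: 2%N], t; split=> //=.
    by rewrite size_nseq.
  rewrite -[<< _ ++ _ >>]consHU stuffle_cons_one /= IHt linearP /= !consHU addrA.
  rewrite -[t.+2]addn1 natrD scalerDl scale1r; congr (_ + _); exact: addrAC.
have adm_g := admissible_behead adm.
have [e span_e IHt] := IHg adm_g.
have b_gt0 : (0 < b)%N by move: adm => /andP [/andP []].
exists (consH b e + << [:: 1%N, b & g] ++ nseq t 1%N >>
    + << (b.+1 :: g) ++ nseq t 1%N >>).
  apply: spanD; first apply: spanD.
  - apply: span_consH span_e => k [g' [i [[adm' g'0] it -> sz]]].
    by exists (b :: g'), i; split=> //; split=> //; exact: admissible_cons.
  - apply: span_basis; exists [:: 1%N, b & g], t; split=> //.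
    by rewrite size_cat size_nseq.
  - apply: span_basis; exists (b.+1 :: g), t; split=> //;
      first by split=> //; exact: admissible_cons.
    by rewrite size_cat size_nseq.
rewrite /= -[<< b :: _ >>]consHU stuffle_cons_one IHt linearP /= !consHU.
by rewrite !addrA.
Qed.

Definition decomposable (r : nat) (u : formal) : Prop :=
  exists w : nat -> formal, (forall l, inH0 (w l)) /\
    u = \sum_(l < r.+1) stuffle (w l) (stuffle_pow1 l).

Lemma inH0D u v : inH0 u -> inH0 v -> inH0 (u + v).
Proof.
move=> /allP Pu /allP Pv; apply/allP => k /domD_subset.
by rewrite mem_cat => /orP [/Pu|/Pv].
Qed.

Lemma inH0Z c u : inH0 u -> inH0 (c *: u).
Proof. by move=> /allP Pu; apply/allP => k /domZ_subset /Pu. Qed.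

Lemma inH0_0 : inH0 0.
Proof. by rewrite /inH0 dom0. Qed.

Lemma decomposable0 r : decomposable r 0.
Proof.
exists (fun=> 0); split; first by move=> l; exact: inH0_0.
by rewrite big1 // => i _; rewrite stuffle0l.
Qed.

Lemma decomposableP r c u v :
  decomposable r u -> decomposable r v -> decomposable r (c *: u + v).
Proof.
move=> [w [wH0 ->]] [w' [w'H0 ->]]; exists (fun l => c *: w l + w' l).
split; first by move=> l; rewrite inH0D ?inH0Z.
rewrite scaler_sumr -big_split /=.
by apply: eq_bigr => l _; rewrite stuffleDl stuffleZl.
Qed.

Lemma decomposable_mono r r' u :
  (r <= r')%N -> decomposable r u -> decomposable r' u.
Proof.
move=> rr' [w [wH0 ->]]; exists (fun l => if (l < r.+1)%N then w l else 0).
split; first by move=> l; case: ifP => // _; exact: inH0_0.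
rewrite (big_ord_widen r'.+1 (fun l => stuffle (w l) (stuffle_pow1 l))) //.
rewrite big_mkcond /=.
by apply: eq_bigr => l _; case: ifP => // _; rewrite stuffle0l.
Qed.

Lemma decomposable_mul1 r u :
  decomposable r u -> decomposable r.+1 (stuffle u << [:: 1%N] >>).
Proof.
move=> [w [wH0 ->]]; exists (fun l => if l is l'.+1 then w l' else 0).
split; first by case=> //; exact: inH0_0.
rewrite [RHS]big_ord_recl /= stuffle0l add0r stuffle_suml.
by apply: eq_bigr => l _; rewrite -stuffleA [X in stuffle _ X]stuffleC.
Qed.

Lemma decomposable_span P r u :
  (forall k, P k -> decomposable r << k >>) -> span P u -> decomposable r u.
Proof.
move=> Pdec; elim=> [|c k v Pk _ IHv]; first exact: decomposable0.
exact: decomposableP (Pdec _ Pk) IHv.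
Qed.

(** Solving [stuffle_trailing_ones] for the word with the longest run of ones
divides by t + 1: this is where rational coefficients are needed. *)
Lemma decomposable_trailing_ones t g :
  admissible g -> decomposable (size g + t) << g ++ nseq t 1%N >>.
Proof.
elim/ltn_ind: t g => -[|t] IHt g adm.
  apply: (@decomposable_mono 0%N) => //.
  exists (fun l => << g >>); split; first by move=> l; rewrite /inH0 domU1 /= adm.
  by rewrite big_ord1 stuffle1r cats0.
have [e span_e E] := stuffle_trailing_ones t adm.
have -> : << g ++ nseq t.+1 1%N >> =
    t.+1%:R^-1 *: (stuffle << g ++ nseq t 1%N >> << [:: 1%N] >> + ((-1) *: e + 0)).
  by rewrite E addr0 scaleN1r addrK scalerA mulVf ?scale1r // pnatr_eq0.
rewrite -[_ *: _]addr0 addnS; apply: decomposableP (decomposable0 _).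
rewrite -[stuffle _ _]scale1r; apply: decomposableP.
  exact/decomposable_mul1/IHt.
apply: decomposableP (decomposable0 _); apply: decomposable_span span_e.
move=> k [g' [i [[adm' _] it -> sz]]].
apply: decomposable_mono (IHt _ _ _ adm') => //.
by move: sz; rewrite size_cat size_nseq.
Qed.

Lemma index_trailing_ones k :
  is_index k -> exists g t, admissible g /\ k = g ++ nseq t 1%N.
Proof.
elim/last_ind: k => [_|k a IHk]; first by exists [::], 0%N.
rewrite /is_index all_rcons => /andP [a_gt0 idx_k].
have [a1|a_neq1] := eqVneq a 1%N.
  have [g [t [adm ->]]] := IHk idx_k; exists g, t.+1; split=> //.
  by rewrite a1 -cats1 -catA -[in RHS]addn1 nseqD.
exists (rcons k a), 0%N; split; last by rewrite cats0.
rewrite /admissible /is_index all_rcons last_rcons a_gt0 /=; apply/andP; split=> //.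
by apply/orP; right; case: a a_gt0 a_neq1 => [|[]].
Qed.

Lemma reg_decompP k : is_index k -> is_reg_decomp (reg_decomp k).
Proof.
move=> /index_trailing_ones [g [t [adm Ek]]]; rewrite /reg_decomp.
have [w [wH0 Ew]] := decomposable_trailing_ones t adm.
apply: (@xgetPex _ _ [set u | @is_reg_decomp k u]).
exists [ffun l : 'I_(size k).+1 => w l]; split; first by move=> l; rewrite ffunE.
rewrite {1}Ek Ew.
have -> : (size g + t)%N = size k by rewrite Ek size_cat size_nseq.
by apply: eq_bigr => l _; rewrite ffunE.
Qed.


(** * Truncated sums as monomial quasi-symmetric polynomials *)

Section LinearExtension.
Variables (F : numFieldType) (f : seq nat -> F).

Definition lin_ext (u : formal) : F := \sum_(a <- dom u) ratr (coeff a u) * f a.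

(** Summing over a common list that contains both domains makes additivity of
[lin_ext] visible, although cancellation can shrink the domain of a sum. *)
Lemma lin_ext_subset (S : seq (seq nat)) u : uniq S -> {subset dom u <= S} ->
  lin_ext u = \sum_(a <- S) ratr (coeff a u) * f a.
Proof.
move=> uniqS subS; rewrite [RHS](bigID (mem (dom u))) /= [X in _ + X]big1 ?addr0.
  rewrite -big_filter; apply: perm_big.
  apply: uniq_perm; rewrite ?uniq_dom ?filter_uniq // => a.
  by rewrite mem_filter andbC; case: (boolP (a \in dom u)) => [/subS ->|_]; rewrite ?andbF.
by move=> a /coeff_outdom ->; rewrite rmorph0 mul0r.
Qed.

Lemma lin_extP c u v : lin_ext (c *: u + v) = ratr c * lin_ext u + lin_ext v.
Proof.
pose S := undup (dom u ++ dom v).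
have uniqS : uniq S by exact: undup_uniq.
rewrite !(@lin_ext_subset S) // => [|a av|a au|a];
  try by rewrite mem_undup mem_cat ?au ?av ?orbT.
  rewrite mulr_sumr -big_split /=; apply: eq_bigr => a _.
  by rewrite coeffD coeffZ rmorphD rmorphM /= mulrDl mulrA.
rewrite mem_undup => /domD_subset; rewrite !mem_cat.
by move=> /orP [/domZ_subset ->|->]; rewrite ?orbT.
Qed.

Lemma lin_ext0 : lin_ext 0 = 0.
Proof. by rewrite /lin_ext dom0 big_nil. Qed.

Lemma lin_extD u v : lin_ext (u + v) = lin_ext u + lin_ext v.
Proof. by rewrite -[u]scale1r lin_extP rmorph1 mul1r scale1r. Qed.

Lemma lin_ext_basis k : lin_ext << k >> = f k.
Proof. by rewrite /lin_ext domU1 big_seq1 coeffU mul1r eqxx rmorph1 mul1r. Qed.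

Lemma lin_ext_sum (I : Type) (r : seq I) (u : I -> formal) :
  lin_ext (\sum_(i <- r) u i) = \sum_(i <- r) lin_ext (u i).
Proof. by apply: (big_morph lin_ext lin_extD lin_ext0). Qed.

End LinearExtension.

Section Qsym.
Variable F : numFieldType.
Implicit Types (w : seq F) (k l : seq nat).

(** The monomial quasi-symmetric polynomial of the composition k at the finite
list w: the sum, over strictly increasing positions in w, of the products of
powers with exponents k. *)
Fixpoint qsym w k {struct w} : F :=
  match k, w with
  | [::], _ => 1
  | _ :: _, [::] => 0
  | a :: k', x :: w' => x ^+ a * qsym w' k' + qsym w' k
  end.

Lemma qsym_nil w : qsym w [::] = 1. Proof. by case: w. Qed.

Lemma lin_ext_qsym_nil a u : lin_ext (qsym [::]) (consH a u) = 0.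
Proof.
elim/formal_ind: u => [|c k u IHu]; first by rewrite raddf0 lin_ext0.
by rewrite linearP /= consHU lin_extP lin_ext_basis IHu mulr0 addr0.
Qed.

Lemma lin_ext_qsym_cons x w a u :
  lin_ext (qsym (x :: w)) (consH a u) =
    x ^+ a * lin_ext (qsym w) u + lin_ext (qsym w) (consH a u).
Proof.
elim/formal_ind: u => [|c k u IHu]; first by rewrite raddf0 !lin_ext0 mulr0 addr0.
rewrite linearP /= consHU !lin_extP !lin_ext_basis IHu /=.
by ring.
Qed.

(** Splitting off the first variable x of w, the terms of a product that
involve x come from the left factor, from the right factor, or from both:
these are the three terms of the stuffle recursion. *)
Lemma qsymM w u v :
  lin_ext (qsym w) (stuffle u v) = lin_ext (qsym w) u * lin_ext (qsym w) v.
Proof.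
elim/formal_ind: u => [|c k u IHu]; first by rewrite stuffle0l !lin_ext0 mul0r.
rewrite stuffleDl stuffleZl !lin_extP IHu mulrDl; congr (_ + _) => {u IHu}.
rewrite -[RHS]mulrA; congr (_ * _) => {c}.
elim/formal_ind: v => [|c l v IHv]; first by rewrite linear0 !lin_ext0 mulr0.
rewrite linearP /= !lin_extP IHv mulrDr; congr (_ + _) => {v IHv}.
rewrite [RHS]mulrCA; congr (_ * _) => {c}.
elim: w k l => [|x w IHw] [|a k] [|b l];
  rewrite ?stuffle1l ?stuffle1r ?lin_ext_basis /= ?mulr1 ?mul1r //.
  by rewrite -!consHU stuffle_cons !lin_extD !lin_ext_qsym_nil mul0r !addr0.
have := IHw (a :: k) (b :: l); rewrite -!consHU !stuffle_cons.
rewrite !lin_extD !lin_ext_qsym_cons !consHU !IHw !lin_ext_basis exprD => E.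
by rewrite mulrDl !mulrDr -E; ring.
Qed.

Lemma qsym_pow1 w n : lin_ext (qsym w) (stuffle_pow1 n) = qsym w [:: 1%N] ^+ n.
Proof.
elim: n => [|n IHn]; first by rewrite lin_ext_basis qsym_nil.
by rewrite /= qsymM IHn lin_ext_basis exprS.
Qed.

Lemma qsym_rcons w x k a :
  qsym (rcons w x) (rcons k a) = qsym w (rcons k a) + x ^+ a * qsym w k.
Proof.
elim: w k => [|y w IHw] [|b k] /=; rewrite ?mulr1 ?mulr0 ?addr0 ?add0r //.
- by case: k => *; rewrite /= mulr0.
- by have := IHw [::]; rewrite /= => ->; rewrite !qsym_nil addrA; ring.
by rewrite IHw (IHw (b :: k)); ring.
Qed.

Lemma qsym_iota (y : nat -> F) a k m N : (m <= N)%N ->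
  qsym [seq y n | n <- iota m.+1 (N - m)] (a :: k) =
    \sum_(m.+1 <= n < N.+1) y n ^+ a * qsym [seq y i | i <- iota n.+1 (N - n)] k.
Proof.
move=> mN; move Ed: (N - m)%N => d; elim: d m mN Ed => [|d IHd] m mN Ed.
  by rewrite big_geq // ltnS -subn_eq0 Ed.
have mltN : (m < N)%N by rewrite -subn_gt0 Ed.
have {}Ed : (N - m.+1 = d)%N by rewrite subnS Ed.
by rewrite big_ltn // -(IHd m.+1) //= Ed.
Qed.

Lemma big_tuple_cons (I : finType) n (P : pred (n.+1.-tuple I)) (G : n.+1.-tuple I -> F) :
  \sum_(t | P t) G t =
    \sum_(i : I) \sum_(t : n.-tuple I | P [tuple of i :: t]) G [tuple of i :: t].
Proof.
rewrite pair_big_dep /= (reindex (fun p : I * n.-tuple I => [tuple of p.1 :: p.2])) //=.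
exists (fun t => (thead t, [tuple of behead t])) => [[i t] _|t _] /=.
  by congr pair; apply: val_inj.
by rewrite -tuple_eta.
Qed.

Lemma sum_increasing_tuples (y : nat -> F) k m N : (m <= N)%N ->
  \sum_(n : (size k).-tuple 'I_N.+1 | path ltn m [seq val i | i <- n])
    \prod_(i < size k) y (tnth n i) ^+ nth 0%N k i =
  qsym [seq y n | n <- iota m.+1 (N - m)] k.
Proof.
elim: k m => [|a k IHk] m mN.
  rewrite qsym_nil (big_pred1 [tuple]) ?big_ord0 // => t.
  by rewrite tuple0 /= eqxx.
rewrite qsym_iota // big_tuple_cons.
have -> : \sum_(m.+1 <= n < N.+1) y n ^+ a * qsym [seq y i | i <- iota n.+1 (N - n)] k
  = \sum_(n < N.+1 | (m < n)%N) y n ^+ a * qsym [seq y i | i <- iota n.+1 (N - n)] k.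
  by rewrite (big_nat_widenl m.+1 0) // big_mkord.
rewrite [RHS]big_mkcond; apply: eq_bigr => i _ /=.
case: ifP => mi; last by rewrite big_pred0.
rewrite -IHk; last by rewrite -ltnS.
rewrite mulr_sumr; apply: eq_bigr => t _.
by rewrite big_ord_recl tnth0; congr (_ * _); apply: eq_bigr => j _; rewrite tnthS.
Qed.

End Qsym.

Section Truncations.
Variable R : realType.
Implicit Types (s : R[i]) (k : seq nat).

Definition shifted_inv s (N : nat) : seq R[i] := [seq (n%:R + s)^-1 | n <- iota 1 N].

(** The tuples of the definition are the increasing choices of positions. *)
Lemma zeta_truncE k s N : zeta_trunc k s N = qsym (shifted_inv s N) k.
Proof.
rewrite /shifted_inv -[N in iota _ N]subn0.
rewrite -(sum_increasing_tuples (fun n => (n%:R + s)^-1)) //.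
apply: eq_bigr => n _; apply: eq_bigr => i _.
by rewrite exprVn.
Qed.

Lemma shifted_invS s N : shifted_inv s N.+1 = rcons (shifted_inv s N) (N.+1%:R + s)^-1.
Proof. by rewrite /shifted_inv -[N.+1 in LHS]addn1 iotaD map_cat cats1 add1n. Qed.

(** Together with the recursion of [qsym], this is the shift relation at the
level of truncated series. *)
Lemma shifted_inv_cons s N : shifted_inv s N.+1 = (1 + s)^-1 :: shifted_inv (s + 1) N.
Proof.
rewrite /shifted_inv /= (iotaDl 1 1) -map_comp; congr (_ :: _).
by apply: eq_map => n /=; congr (_^-1); rewrite natrD; ring.
Qed.

End Truncations.

(** * Growth of the harmonic numbers *)

Section Growth.
Variable R : realType.

Definition harmonic_num (N : nat) : R := series harmonic N.
(* Adding 1 makes the powers of L N increase with the exponent. *)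
Local Notation L N := (1 + harmonic_num N).
Local Notation r N := (Num.sqrt N.+1%:R : R).

Lemma harmonic_numS N : harmonic_num N.+1 = harmonic_num N + N.+1%:R^-1.
Proof. by rewrite /harmonic_num /series /= big_nat_recr. Qed.

Lemma harmonic_num0 : harmonic_num 0 = 0.
Proof. by rewrite /harmonic_num /series /= big_geq. Qed.

Lemma harmonic_num_ge0 N : 0 <= harmonic_num N.
Proof.
by elim: N => [|N IHN]; rewrite ?harmonic_num0 // harmonic_numS addr_ge0.
Qed.

Lemma L_ge1 N : 1 <= L N. Proof. by rewrite lerDl harmonic_num_ge0. Qed.

Lemma L_gt0 N : 0 < L N. Proof. exact: lt_le_trans (L_ge1 N). Qed.

Lemma harmonic_num_nd : {homo harmonic_num : m n / (m <= n)%N >-> m <= n}.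
Proof. by apply/nondecreasing_seqP => n; rewrite harmonic_numS lerDl. Qed.

Lemma harmonic_num_unbounded (A : R) : exists N, A <= L N.
Proof.
apply: contrapT => bnd; apply: (@dvg_harmonic R).
apply: nondecreasing_is_cvgn; first exact: harmonic_num_nd.
exists A => _ [N _ <-]; have [//|AL] := leP (harmonic_num N) A.
by exfalso; apply: bnd; exists N; lra.
Qed.

Lemma sqrt_succ_gt0 N : 0 < r N. Proof. by rewrite sqrtr_gt0. Qed.

Lemma sqrt_succ_sqr N : r N ^+ 2 = N.+1%:R. Proof. by rewrite sqr_sqrtr. Qed.

Lemma sqrt_succ_step N : 1 <= 2 * r N.+1 * (r N.+1 - r N).
Proof.
have e1 : r N.+1 ^+ 2 = r N ^+ 2 + 1 by rewrite !sqrt_succ_sqr natr1.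
have : r N <= r N.+1 by rewrite ler_wsqrtr // ler_nat.
by move: (r N) (r N.+1) e1 => x y e xy; have := sqr_ge0 (y - x); nra.
Qed.

Lemma sqrt_succ_double N : r N.+1 ^+ 2 <= 2 * r N ^+ 2.
Proof. by rewrite !sqrt_succ_sqr -natrM ler_nat; lia. Qed.

Lemma pow_step (x y : R) q : 0 <= y <= x ->
  x ^+ q.+1 - y ^+ q.+1 <= q.+1%:R * x ^+ q * (x - y).
Proof.
move=> /andP [y0 yx]; have x0 := le_trans y0 yx.
elim: q => [|q IHq]; first by rewrite !expr1 expr0 !mul1r.
have := ler_wpM2l x0 IHq.
have : y ^+ q.+1 <= x ^+ q.+1 by rewrite lerXn2r ?nnegrE.
have xy0 : 0 <= x - y by rewrite subr_ge0.
move=> /(ler_wpM2r xy0); rewrite -[q.+2%:R]natr1 !exprS.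
by move: (x ^+ q) (y ^+ q) (q.+1%:R) => X Y n; lra.
Qed.

(** By induction on q: the increments of the power q + 1 are at most
(q + 1) (L N)^q / N, hence O(N^(-1/2)) by the case q, and these sum to
O(N^(1/2)).  The square root is only a convenient exponent strictly between 0
and 1. *)
Lemma harmonic_growth q : exists2 C, 1 <= C & forall N, L N ^+ q <= C * r N.
Proof.
elim: q => [|q [C C1 IHq]].
  exists 1 => // N; rewrite expr0 mul1r -[X in X <= _]sqrtr1.
  by rewrite ler_wsqrtr // ler1n.
(* One factor 2 comes from N + 2 <= 2 (N + 1), the other from
   r N + r N.+1 <= 2 (r N.+1). *)
exists (4 * q.+1%:R * C).
  have : 1 <= q.+1%:R :> R by rewrite ler1n.
  by move: (q.+1%:R) => n n1; nra.
elim=> [|N IHN].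
  rewrite harmonic_num0 addr0 expr1n sqrtr1 mulr1.
  have : 1 <= q.+1%:R :> R by rewrite ler1n.
  by move: (q.+1%:R) => n n1; nra.
have step : L N.+1 ^+ q.+1 - L N ^+ q.+1 <= q.+1%:R * L N.+1 ^+ q * N.+1%:R^-1.
  have -> : N.+1%:R^-1 = L N.+1 - L N.
    by rewrite harmonic_numS addrA [X in X - _]addrC addrK.
  by apply: pow_step; rewrite ltW ?L_gt0 //= harmonic_numS addrA lerDl.
have bnd := IHq N.+1.
have q1 : 1 <= q.+1%:R :> R by rewrite ler1n.
have r0 := sqrt_succ_gt0 N; have r1 := sqrt_succ_gt0 N.+1; have st := sqrt_succ_step N.
have db := sqrt_succ_double N; rewrite -(sqrt_succ_sqr N) in step.
have {}step : L N.+1 ^+ q.+1 - L N ^+ q.+1 <= q.+1%:R * (C * r N.+1) * (r N ^+ 2)^-1.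
  apply: le_trans step _; rewrite ler_wpM2r ?invr_ge0 ?sqr_ge0 //.
  by rewrite ler_wpM2l.
have key : r N.+1 * (r N ^+ 2)^-1 <= 4 * (r N.+1 - r N).
  rewrite ler_pdivrMr ?exprn_gt0 //.
  move: (r N) (r N.+1) r0 r1 st db => x y x0 y0 st db.
  have yx : 0 <= y - x by nra.
  have := ler_wpM2l (ltW y0) st.
  have : y ^+ 2 * (y - x) <= 2 * x ^+ 2 * (y - x) by rewrite ler_wpM2r.
  nra.
have qC : 0 <= q.+1%:R * C by rewrite mulr_ge0 // (le_trans _ C1).
have {key qC bnd st db} := ler_wpM2l qC key; move: step IHN => /[swap].
move: ((r N ^+ 2)^-1) (r N) (r N.+1) (L N ^+ q.+1) (L N.+1 ^+ q.+1) (q.+1%:R).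
by move=> *; lra.
Qed.

(** * The real-valued modulus of complex numbers *)

Lemma normcE (z : R[i]) : `|z| = (normc z)%:C.
Proof. by []. Qed.

Lemma normc_ge0 (z : R[i]) : 0 <= normc z.
Proof. by rewrite -ler0c -normcE. Qed.

Lemma normcD (x y : R[i]) : normc (x + y) <= normc x + normc y.
Proof. by rewrite -lecR rmorphD /= -!normcE ler_normD. Qed.

Lemma normcB (x y : R[i]) : normc x - normc y <= normc (x - y).
Proof. by rewrite -lecR rmorphB /= -!normcE lerB_dist. Qed.

Lemma normcN (x : R[i]) : normc (- x) = normc x.
Proof. by apply: complexI; rewrite -!normcE normrN. Qed.

Lemma normcX (x : R[i]) n : normc (x ^+ n) = normc x ^+ n.
Proof. by apply: complexI; rewrite rmorphXn -!normcE normrX. Qed.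

Lemma normcR (x : R) : 0 <= x -> normc x%:C = x.
Proof. by move=> x0; rewrite /= expr0n addr0 sqrtr_sqr ger0_norm. Qed.

Lemma normc_nat n : normc (n%:R : R[i]) = n%:R.
Proof. by apply: complexI; rewrite -normcE normr_nat rmorph_nat. Qed.

Lemma normc_Re (z : R[i]) : `|complex.Re z| <= normc z.
Proof.
by case: z => a b /=; rewrite -sqrtr_sqr ler_wsqrtr // lerDl sqr_ge0.
Qed.

Lemma normc_Im (z : R[i]) : `|complex.Im z| <= normc z.
Proof.
by case: z => a b /=; rewrite -sqrtr_sqr ler_wsqrtr // lerDr sqr_ge0.
Qed.

Lemma normc_le (z : R[i]) : normc z <= `|complex.Re z| + `|complex.Im z|.
Proof.
case: z => a b /=; rewrite -[leRHS]ger0_norm ?addr_ge0 // -sqrtr_sqr ler_wsqrtr //.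
by rewrite sqrrD !real_normK ?num_real // addrAC lerDl mulrn_wge0 ?mulr_ge0.
Qed.

(** * Sequences that are negligible against powers of the harmonic numbers *)

(** Being o(1) is not preserved by multiplication with h_N; this stronger
notion makes negligible sequences an ideal among those of polynomial growth
in h_N. *)
Definition small (u : nat -> R[i]) :=
  forall q, exists C : R, forall N, normc (u N) * L N ^+ q <= C.

Definition moderate (u : nat -> R[i]) :=
  exists q, exists2 C : R, 0 <= C & forall N, normc (u N) <= C * L N ^+ q.

Lemma L_pow_ge1 N q : 1 <= L N ^+ q.
Proof. by rewrite exprn_ege1 ?L_ge1. Qed.

Lemma eq_small u v : u =1 v -> small u -> small v.
Proof. by move=> uv su q; have [C HC] := su q; exists C => N; rewrite -uv. Qed.

Lemma smallD u v : small u -> small v -> small (fun N => u N + v N).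
Proof.
move=> su sv q; have [C HC] := su q; have [D HD] := sv q; exists (C + D) => N.
apply: le_trans (lerD (HC N) (HD N)); rewrite -mulrDl.
by rewrite ler_wpM2r ?normcD // (le_trans _ (L_pow_ge1 _ _)).
Qed.

Lemma smallN u : small u -> small (fun N => - u N).
Proof. by move=> su q; have [C HC] := su q; exists C => N; rewrite normcN. Qed.

Lemma small0 : small (fun=> 0).
Proof. by move=> q; exists 0 => N; rewrite normc0 mul0r. Qed.

Lemma small_sum (I : Type) (s : seq I) (P : pred I) (u : I -> nat -> R[i]) :
  (forall i, P i -> small (u i)) -> small (fun N => \sum_(i <- s | P i) u i N).
Proof.
move=> su; elim: s => [|i s IHs].
  by apply: eq_small small0 => N; rewrite big_nil.
have [Pi|nPi] := boolP (P i); last first.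
  by apply: eq_small IHs => N; rewrite big_cons (negbTE nPi).
by apply: eq_small (smallD (su i Pi) IHs) => N; rewrite big_cons Pi.
Qed.

Lemma moderateD u v : moderate u -> moderate v -> moderate (fun N => u N + v N).
Proof.
move=> [q [C C0 HC]] [p [D D0 HD]]; exists (q + p)%N.
exists (C + D); first exact: addr_ge0.
move=> N; apply: le_trans (normcD _ _) _; rewrite mulrDl lerD //.
  apply: le_trans (HC N) _; rewrite ler_wpM2l // exprD ler_peMr ?L_pow_ge1 //.
  by rewrite (le_trans _ (L_pow_ge1 _ _)).
apply: le_trans (HD N) _; rewrite ler_wpM2l // exprD ler_peMl ?L_pow_ge1 //.
by rewrite (le_trans _ (L_pow_ge1 _ _)).
Qed.

Lemma moderateM u v : moderate u -> moderate v -> moderate (fun N => u N * v N).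
Proof.
move=> [q [C C0 HC]] [p [D D0 HD]]; exists (q + p)%N.
exists (C * D); first exact: mulr_ge0.
by move=> N; rewrite normcM exprD mulrACA ler_pM ?normc_ge0.
Qed.

Lemma moderate_cst c : moderate (fun=> c).
Proof. by exists 0%N, (normc c); rewrite ?normc_ge0 // => N; rewrite expr0 mulr1. Qed.

Lemma moderateX u n : moderate u -> moderate (fun N => u N ^+ n).
Proof.
move=> mu; elim: n => [|n IHn]; first exact: moderate_cst.
have [q [C C0 HC]] := moderateM mu IHn.
by exists q, C => // N; rewrite exprS.
Qed.

Lemma moderate_harmonic : moderate (fun N => (harmonic_num N)%:C).
Proof.
exists 1%N, 1 => // N.
by rewrite normcR ?harmonic_num_ge0 // mul1r expr1 lerDr.
Qed.

Lemma small_moderate u : small u -> moderate u.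
Proof.
move=> /(_ 0%N) [C HC]; exists 0%N, C => [|N]; have := HC 0%N.
  by rewrite expr0 mulr1; apply: le_trans; exact: normc_ge0.
by have := HC N; rewrite !expr0 !mulr1.
Qed.

Lemma smallM u v : moderate u -> small v -> small (fun N => u N * v N).
Proof.
move=> [p [C C0 HC]] sv q; have [D HD] := sv (p + q)%N; exists (C * D) => N.
have Lp q' : 0 <= L N ^+ q' by rewrite (le_trans _ (L_pow_ge1 _ _)).
apply: le_trans (ler_wpM2l C0 (HD N)).
rewrite normcM exprD -mulrA [leRHS](_ : _ = C * L N ^+ p * (normc (v N) * L N ^+ q)).
  by rewrite ler_wpM2r // mulr_ge0 // normc_ge0.
by ring.
Qed.

Lemma smallMr u v : small u -> moderate v -> small (fun N => u N * v N).
Proof. by move=> su mv; apply: eq_small (smallM mv su) => N; exact: mulrC. Qed.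

Lemma small_sqrt u (C : R) : (forall N, normc (u N) <= C * (r N)^-1) -> small u.
Proof.
move=> HC q; have [D D1 HD] := harmonic_growth q; exists (C * D) => N.
have C0 : 0 <= C.
  have := le_trans (normc_ge0 _) (HC 0%N).
  by rewrite pmulr_lge0 // invr_gt0 sqrt_succ_gt0.
apply: (@le_trans _ _ (C * (r N)^-1 * (D * r N))).
  by rewrite ler_pM ?normc_ge0 // (le_trans _ (L_pow_ge1 _ _)).
by rewrite [D * _]mulrC mulrA mulfVK // gt_eqF ?sqrt_succ_gt0.
Qed.

Lemma small_cvg u l : small (fun N => u N - l) -> lim ((u : nat -> (R[i])^o) @ \oo) = l.
Proof.
move=> /(_ 1%N) [C HC].
apply: (@cvg_lim (R[i])^o); first exact: (@norm_hausdorff R[i] (R[i])^o).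
apply/cvgrPdist_le => e e0.
have [/eqP Ime Ree] : complex.Im e == 0 /\ 0 < complex.Re e.
  by move: e0; rewrite ltcE => /andP [].
have [N HN] := harmonic_num_unbounded (C / complex.Re e).
exists N => // n /= Nn.
rewrite -[e]RRe_real ?gtr0_real // distrC normcE lecR.
have Ln : C / complex.Re e <= L n.
  by apply: le_trans HN _; rewrite lerD2l harmonic_num_nd.
rewrite -(ler_pM2r (L_gt0 n)) -{1}[L n]expr1; apply: le_trans (HC n) _.
by rewrite mulrC -ler_pdivrMr.
Qed.

(** The intervals of radius B (g N) around x N decrease with N, so they have
a common point. *)
Lemma real_telescope (x g : nat -> R) (B : R) :
  (forall N, `|x N.+1 - x N| <= B * (g N - g N.+1)) -> 
  (forall N, 0 <= B * g N) ->
  exists l, forall N, `|x N - l| <= B * g N.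
Proof.
move=> step g0.
have lo : {homo (fun N => x N - B * g N) : m n / (m <= n)%N >-> m <= n}.
  by apply/nondecreasing_seqP => n; have := step n; rewrite ler_norml => /andP []; lra.
have up : {homo (fun N => x N + B * g N) : m n / (m <= n)%N >-> n <= m}.
  by apply/nonincreasing_seqP => n; have := step n; rewrite ler_norml => /andP []; lra.
have cross M N : x M - B * g M <= x N + B * g N.
  have := lo _ _ (leq_maxl M N); have := up _ _ (leq_maxr M N).
  by have := g0 (maxn M N); lra.
pose E := range (fun N => x N - B * g N).
have supE : has_sup E.
  by split; [exists (x 0%N - B * g 0%N), 0%N | exists (x 0%N + B * g 0%N) => _ [M _ <-]].
exists (sup E) => N; rewrite ler_distl; apply/andP; split.
  by rewrite lerBlDr; apply: ge_sup; [case: supE | move=> _ [M _ <-]; exact: cross].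
by rewrite -lerBlDr; apply: ub_le_sup; [case: supE | exists N].
Qed.

(** The increments are O(N^(-3/2)) by [harmonic_growth], hence dominated by
those of the sequence N^(-1/2). *)
Lemma small_telescope (x : nat -> R[i]) (C : R) p :
  0 <= C -> (forall N, normc (x N.+1 - x N) <= C * L N ^+ p * N.+1%:R^-1 ^+ 2) ->
  exists l, small (fun N => x N - l).
Proof.
move=> C0 step; have [D D1 HD] := harmonic_growth p.
pose B := 4 * C * D.
have B0 : 0 <= B by rewrite !mulr_ge0 // (le_trans _ D1).
have g0 N : 0 <= B * (r N)^-1 by rewrite mulr_ge0 // invr_ge0 ltW ?sqrt_succ_gt0.
have {}step N : normc (x N.+1 - x N) <= B * ((r N)^-1 - (r N.+1)^-1).
  apply: le_trans (step N) _; rewrite -[in leLHS]sqrt_succ_sqr.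
  have r0 := sqrt_succ_gt0 N; have r1 := sqrt_succ_gt0 N.+1.
  apply: (@le_trans _ _ (C * D * ((r N)^-1) ^+ 3)).
    rewrite -!mulrA ler_wpM2l //.
    apply: le_trans (ler_wpM2r _ (HD N)) _; first by rewrite sqr_ge0.
    rewrite -mulrA ler_wpM2l ?(le_trans _ D1) // le_eqVlt; apply/orP; left; apply/eqP.
    by field; rewrite gt_eqF.
  have -> : B * ((r N)^-1 - (r N.+1)^-1) = C * D * (4 * ((r N)^-1 - (r N.+1)^-1)).
    by rewrite /B; ring.
  rewrite ler_wpM2l ?mulr_ge0 ?(le_trans _ D1) //.
  have st := sqrt_succ_step N; have db := sqrt_succ_double N.
  move: (r N) (r N.+1) r0 r1 st db => a b a0 b0 st db.
  have ba : 0 <= b - a by nra.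
  have key : b <= 4 * (b - a) * a ^+ 2.
    by have := ler_wpM2r ba db; have := ler_wpM2l (ltW b0) st; lra.
  have -> : a^-1 ^+ 3 = b * (a ^+ 3 * b)^-1 by field; rewrite !gt_eqF.
  have -> : 4 * (a^-1 - b^-1) = 4 * (b - a) * a ^+ 2 * (a ^+ 3 * b)^-1.
    by field; rewrite !gt_eqF.
  by rewrite ler_wpM2r // invr_ge0 mulr_ge0 ?exprn_ge0 ?ltW.
have Re_step N : `|complex.Re (x N.+1) - complex.Re (x N)|
    <= B * ((r N)^-1 - (r N.+1)^-1).
  by rewrite -raddfB; apply: le_trans (normc_Re _) (step N).
have Im_step N : `|complex.Im (x N.+1) - complex.Im (x N)|
    <= B * ((r N)^-1 - (r N.+1)^-1).
  by rewrite -raddfB; apply: le_trans (normc_Im _) (step N).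
have [a Ha] := real_telescope Re_step g0.
have [b Hb] := real_telescope Im_step g0.
exists (a +i* b); apply: (@small_sqrt _ (2 * B)) => N.
apply: le_trans (normc_le _) _; rewrite !raddfB /=.
by have := Ha N; have := Hb N; lra.
Qed.

(** Over an algebraically closed field p is a product of linear factors, each
of modulus at least 1 far out on the real axis; so p is bounded below there by
its leading coefficient. *)
Lemma small_poly_harmonic (p : {poly R[i]}) :
  small (fun N => p.[(harmonic_num N)%:C]) -> p = 0.
Proof.
move=> /(_ 1%N) [C HC]; apply/eqP/negPn/negP => p0.
have [s Es] := closed_field_poly_normal p.
(* The sum is a common bound for all roots; 2 is 1 for the distance to the
   roots plus 1 for the shift L N = 1 + h_N. *)
pose A := 2 + \sum_(z <- s) normc z.
have far N : A <= L N -> normc (lead_coef p) <= normc p.[(harmonic_num N)%:C].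
  move=> AN; rewrite {2}Es hornerZ normcM ler_peMr ?normc_ge0 // horner_prod.
  have {AN} : 1 + \sum_(z <- s) normc z <= harmonic_num N by rewrite /A in AN; lra.
  elim: (s) => [|z s' IHs]; first by rewrite !big_nil normc1.
  rewrite !big_cons hornerXsubC => AN.
  have z0 := normc_ge0 z.
  have s0 : 0 <= \sum_(z <- s') normc z by apply: sumr_ge0 => ? _; exact: normc_ge0.
  have IH : 1 <= normc (\prod_(j <- s') ('X - j%:P).[(harmonic_num N)%:C]).
    by apply: IHs; lra.
  rewrite normcM mulr_ege1 //.
  by have := normcB (harmonic_num N)%:C z; rewrite normcR ?harmonic_num_ge0 //; lra.
have lc_gt0 : 0 < normc (lead_coef p).
  rewrite lt_neqAle normc_ge0 andbT eq_sym; apply: contra p0 => /eqP /eq0_normc /eqP.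
  by rewrite lead_coef_eq0.
have [N HN] := harmonic_num_unbounded (Num.max A ((C + 1) / normc (lead_coef p))).
move: HN; rewrite ge_max => /andP [/far AN]; rewrite ler_pdivrMr // => BN.
have := HC N; rewrite expr1 => {}HC.
have : normc (lead_coef p) * L N <= C.
  by apply: le_trans HC; rewrite ler_wpM2r // ltW ?L_gt0.
by rewrite mulrC; lra.
Qed.

Lemma small_inv_succ : small (fun N => (N.+1%:R)^-1).
Proof.
apply: (@small_sqrt _ 1) => N; rewrite normcV normc_nat -[in leLHS]sqrt_succ_sqr mul1r.
rewrite expr2 invfM ler_piMl ?invr_ge0 ?(ltW (sqrt_succ_gt0 N)) //.
rewrite invf_le1 ?sqrt_succ_gt0 //.
by rewrite -[X in X <= _]sqrtr1 ler_wsqrtr // ler1n.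
Qed.

Lemma moderate_poly_harmonic (p : {poly R[i]}) :
  moderate (fun N => p.[(harmonic_num N)%:C]).
Proof.
elim/poly_ind: p => [|p c IHp].
  by exists 0%N, 0 => // N; rewrite horner0 normc0 mul0r.
have [q [C C0 HC]] := moderateD (moderateM IHp moderate_harmonic) (moderate_cst c).
by exists q, C => // N; rewrite hornerMXaddC.
Qed.

(** Needed because the shift s + 1 pairs a truncation at N with one at
N + 1. *)
Lemma small_poly_harmonic_step (p : {poly R[i]}) :
  small (fun N => p.[(harmonic_num N.+1)%:C] - p.[(harmonic_num N)%:C]).
Proof.
elim/poly_ind: p => [|p c IHp].
  by apply: eq_small small0 => N; rewrite !horner0 subrr.
have step : small (fun N => (harmonic_num N.+1)%:C - (harmonic_num N)%:C).
  apply: eq_small small_inv_succ => N.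
  by rewrite harmonic_numS rmorphD /= addrC addKr fmorphV rmorph_nat.
have mS : moderate (fun N => (harmonic_num N.+1)%:C).
  have [q [C C0 HC]] := moderateD moderate_harmonic (small_moderate step).
  by exists q, C => // N; have := HC N; rewrite subrKC.
apply: eq_small (smallD (smallMr IHp mS) (smallM (moderate_poly_harmonic p) step)) => N.
by rewrite !hornerMXaddC; ring.
Qed.

End Growth.

(** * Asymptotics of the truncated sums *)

Section Asymptotics.
Variable R : realType.
Implicit Types (s T : R[i]) (k : seq nat).

Local Notation h N := (harmonic_num R N).
Local Notation L N := (1 + harmonic_num R N).

(** This also holds when s is a negative integer, since the single singular
term then has value 0 by the convention for the inverse of 0. *)
Lemma shifted_inv_bound s :
  exists2 C : R, 1 <= C & forall N, normc (N.+1%:R + s)^-1 <= C * N.+1%:R^-1.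
Proof.
(* Beyond 2 |s| one has |n + s| >= n / 2; the finitely many other terms are
   bounded by their sum. *)
pose n0 := Num.bound (2 * normc s).
pose term i := i.+1%:R * normc (i.+1%:R + s)^-1.
have term0 i : 0 <= term i by rewrite mulr_ge0 // normc_ge0.
exists (2 + \sum_(i < n0) term i).
  have : 0 <= \sum_(i < n0) term i by apply: sumr_ge0.
  by lra.
move=> N; rewrite ler_pdivlMr ?ltr0n // mulrC -/(term N).
have [Nn0|n0N] := ltnP N n0.
  rewrite (bigD1 (Ordinal Nn0)) //=.
  have : 0 <= \sum_(i < n0 | i != Ordinal Nn0) term i by apply: sumr_ge0.
  by lra.
suff : term N <= 2.
  have : 0 <= \sum_(i < n0) term i by apply: sumr_ge0.
  by lra.
have far : 2 * normc s < N.+1%:R.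
  have : 2 * normc s < n0%:R by apply: archi_boundP; rewrite mulr_ge0 ?normc_ge0.
  move=> /lt_le_trans; apply.
  by rewrite ler_nat leqW.
rewrite /term normcV.
have low : N.+1%:R - normc s <= normc (N.+1%:R + s).
  by have := normcB N.+1%:R (- s); rewrite opprK normcN normc_nat.
have s0 := normc_ge0 s.
by rewrite ler_pdivrMr; lra.
Qed.

Lemma moderate_qsym s k : is_index k -> exists2 C : R, 0 <= C &
  forall N, normc (qsym (shifted_inv s N) k) <= C * L N ^+ size k.
Proof.
elim/last_ind: k => [_|k a IHk].
  by exists 1 => // N; rewrite qsym_nil normc1 mulr1.
rewrite /is_index all_rcons => /andP [a_gt0 /IHk [C C0 HC]].
have [D D1 HD] := shifted_inv_bound s.
exists (D ^+ a * C); first by rewrite mulr_ge0 // exprn_ge0 // (le_trans _ D1).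
have DC0 : 0 <= D ^+ a * C by rewrite mulr_ge0 // exprn_ge0 // (le_trans _ D1).
rewrite size_rcons; elim=> [|N IHN].
  rewrite [qsym _ _](_ : _ = 0); last by case: (k).
  by rewrite normc0 mulr_ge0 // exprn_ge0 // ltW // L_gt0.
rewrite shifted_invS qsym_rcons; apply: le_trans (normcD _ _) _.
apply: (@le_trans _ _ (D ^+ a * C * (L N ^+ (size k).+1 + N.+1%:R^-1 * L N ^+ size k))).
  rewrite mulrDr lerD // normcM normcX.
  have -> : D ^+ a * C * (N.+1%:R^-1 * L N ^+ size k)
      = (D ^+ a * N.+1%:R^-1) * (C * L N ^+ size k) by ring.
  rewrite ler_pM ?exprn_ge0 ?normc_ge0 //.
  apply: le_trans (lerXn2r _ _ _ (HD N)) _; rewrite ?nnegrE ?normc_ge0 //.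
    by rewrite mulr_ge0 ?invr_ge0 // (le_trans _ D1).
  rewrite exprMn ler_wpM2l ?exprn_ge0 ?(le_trans _ D1) //.
  case: (a) a_gt0 => // a' _; rewrite exprS ler_piMr //.
  by rewrite exprn_ile1 ?invr_ge0 ?invf_le1 ?ler1n.
rewrite ler_wpM2l // exprS -mulrDl [X in _ <= X]exprS harmonic_numS addrA.
rewrite ler_pM // ?exprn_ge0 ?addr_ge0 ?harmonic_num_ge0 //.
by rewrite lerXn2r ?nnegrE ?addr_ge0 ?harmonic_num_ge0 // lerDl.
Qed.

(** The last exponent is at least 2, so the increments of the truncations are
O(h_N^r / N^2).  This also shows that the limit defining the series exists. *)
Lemma small_zeta s k : admissible k ->
  small (fun N => qsym (shifted_inv s N) k - zeta k s).
Proof.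
move=> adm; suff [l Hl] : exists l, small (fun N => qsym (shifted_inv s N) k - l).
  suff -> : zeta k s = l by [].
  rewrite /zeta; apply: small_cvg; apply: eq_small Hl => N.
  by rewrite zeta_truncE.
case/lastP: k adm => [_|k a].
  by exists 1; apply: eq_small (@small0 R) => N; rewrite qsym_nil subrr.
rewrite /admissible /is_index all_rcons last_rcons => /andP [/andP [_ idx]].
rewrite -size_eq0 size_rcons /= => a_ge2.
have [C C0 HC] := moderate_qsym s idx.
have [D D1 HD] := shifted_inv_bound s.
apply: (@small_telescope _ _ (D ^+ a * C) (size k)).
  by rewrite mulr_ge0 // exprn_ge0 // (le_trans _ D1).
move=> N; rewrite shifted_invS qsym_rcons addrC addKr normcM normcX.
have -> : D ^+ a * C * L N ^+ size k * N.+1%:R^-1 ^+ 2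
    = (D ^+ a * N.+1%:R^-1 ^+ 2) * (C * L N ^+ size k) by ring.
rewrite ler_pM ?exprn_ge0 ?normc_ge0 //.
apply: le_trans (lerXn2r _ _ _ (HD N)) _; rewrite ?nnegrE ?normc_ge0 //.
  by rewrite mulr_ge0 ?invr_ge0 // (le_trans _ D1).
rewrite exprMn ler_wpM2l ?exprn_ge0 ?(le_trans _ D1) //.
by rewrite ler_wiXn2l ?invr_ge0 ?invf_le1 ?ler1n.
Qed.

Lemma harmonic_truncS s N : harmonic_trunc s N.+1 =
  harmonic_trunc s N + (N.+1%:R^-1 - (N.+1%:R + s)^-1).
Proof. by rewrite /harmonic_trunc big_nat_recr. Qed.

Lemma small_harmonicH s : small (fun N => harmonic_trunc s N - harmonicH s).
Proof.
suff [l Hl] : exists l, small (fun N => harmonic_trunc s N - l).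
  suff -> : harmonicH s = l by [].
  exact: small_cvg.
have [D D1 HD] := shifted_inv_bound s.
apply: (@small_telescope _ _ (normc s * (1 + D)) 0).
  by rewrite mulr_ge0 ?normc_ge0 // addr_ge0 // (le_trans _ D1).
move=> N; rewrite harmonic_truncS addrC addKr expr0 mulr1.
have s0 := normc_ge0 s.
have D0 : 0 <= D by rewrite (le_trans _ D1).
have i2 : 0 <= N.+1%:R^-1 ^+ 2 :> R by rewrite sqr_ge0.
(* The one possibly singular term: there |s| = N + 1, and the increment is
   1 / (N + 1) = |s| / (N + 1)^2. *)
have [E|ns0] := eqVneq (N.+1%:R + s) 0.
  have Es : normc s = N.+1%:R.
    by move/eqP: E; rewrite addrC addr_eq0 => /eqP ->; rewrite normcN normc_nat.
  rewrite E invr0 subr0 normcV normc_nat Es mulrDr mulr1 mulrDl.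
  have -> : N.+1%:R * N.+1%:R^-1 ^+ 2 = N.+1%:R^-1 :> R.
    by rewrite expr2 mulrA mulfV ?mul1r // pnatr_eq0.
  by rewrite lerDl !mulr_ge0.
have -> : N.+1%:R^-1 - (N.+1%:R + s)^-1 = s * (N.+1%:R^-1 * (N.+1%:R + s)^-1).
  have : N.+1%:R != 0 :> R[i] by rewrite pnatr_eq0.
  by move: (N.+1%:R) ns0 => x ns0 x0; field; rewrite ns0.
rewrite !normcM normcV normc_nat -mulrA ler_wpM2l //.
apply: (@le_trans _ _ (N.+1%:R^-1 * (D * N.+1%:R^-1))).
  by rewrite ler_wpM2l ?invr_ge0.
by rewrite mulrCA -expr2 ler_wpM2r // lerDr.
Qed.

Lemma qsym_one s N : qsym (shifted_inv s N) [:: 1%N] = (h N)%:C - harmonic_trunc s N.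
Proof.
elim: N => [|N IHN].
  by rewrite /harmonic_trunc big_geq // harmonic_num0 subr0.
rewrite shifted_invS (qsym_rcons _ _ [::]) IHN qsym_nil harmonic_truncS harmonic_numS.
by rewrite rmorphD /= fmorphV rmorph_nat; ring.
Qed.

(** * The regularized zeta values *)

(** The regularized value with parameter T - H(s), as a polynomial in T. *)
Definition zeta_poly k s : {poly R[i]} :=
  \sum_(l < (size k).+1) (zeta_lin (reg_decomp k l) s) *: ('X - (harmonicH s)%:P) ^+ l.

Lemma horner_zeta_poly k s T : (zeta_poly k s).[T] = zeta_reg (T - harmonicH s) k s.
Proof.
rewrite /zeta_poly horner_sum; apply: eq_bigr => l _.
by rewrite hornerZ horner_exp hornerXsubC.
Qed.

Lemma small_zeta_lin s u : inH0 u ->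
  small (fun N => lin_ext (qsym (shifted_inv s N)) u - zeta_lin u s).
Proof.
move=> /allP H0u; rewrite /zeta_lin /lin_ext.
have su : small (fun N => \sum_(a <- dom u | a \in dom u)
    ratr (coeff a u) * (qsym (shifted_inv s N) a - zeta a s)).
  apply: small_sum => a au; apply: smallM; first exact: moderate_cst.
  exact/small_zeta/H0u.
apply: eq_small su => N; rewrite -big_seq -sumrB.
by apply: eq_bigr => a _; rewrite mulrBr.
Qed.

Lemma small_subX (u v : nat -> R[i]) n : moderate u -> moderate v ->
  small (fun N => u N - v N) -> small (fun N => u N ^+ n - v N ^+ n).
Proof.
move=> mu mv suv; apply: eq_small (smallMr suv (_ : moderate (fun N =>
  \sum_(i < n) u N ^+ (n.-1 - i) * v N ^+ i))) => [N|].
  by rewrite subrXX.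
elim: (n) (n.-1) => [|m IHm] j.
  by have [q [C C0 HC]] := moderate_cst (0 : R[i]); exists q, C => // N; rewrite big_ord0.
have [q [C C0 HC]] :=
  moderateD (IHm j) (moderateM (moderateX (j - m) mu) (moderateX m mv)).
by exists q, C => // N; rewrite big_ord_recr /=.
Qed.

(** Substituting truncations in the decomposition of k; the truncation of the
index (1) is h_N minus a truncation of H(s). *)
Lemma small_zeta_poly s k : is_index k ->
  small (fun N => qsym (shifted_inv s N) k - (zeta_poly k s).[(h N)%:C]).
Proof.
move=> /reg_decompP [H0u Ek].
pose v N := (h N)%:C - harmonic_trunc s N; pose v' N := (h N)%:C - harmonicH s.
have svv' : small (fun N => v N - v' N).
  apply: eq_small (smallN (small_harmonicH s)) => N.
  by rewrite /v /v'; ring.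
have mv' : moderate v'.
  exact: moderateD (moderate_harmonic R) (moderate_cst _).
have mv : moderate v.
  have [q [C C0 HC]] := moderateD mv' (small_moderate svv').
  by exists q, C => // N; have := HC N; rewrite subrKC.
pose t (l : 'I_(size k).+1) N := lin_ext (qsym (shifted_inv s N)) (reg_decomp k l).
pose z (l : 'I_(size k).+1) := zeta_lin (reg_decomp k l) s.
have sl l : small (fun N =>
    (t l N - z l) * v N ^+ l + z l * (v N ^+ l - v' N ^+ l)).
  apply: smallD.
    by apply: smallMr (moderateX l mv); apply: small_zeta_lin.
  by apply: smallM (moderate_cst _) _; apply: small_subX.
have : small (fun N => \sum_(l < (size k).+1)
    ((t l N - z l) * v N ^+ l + z l * (v N ^+ l - v' N ^+ l))).
  by apply: small_sum => l _; exact: sl.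
apply: eq_small => N.
rewrite -[X in X - _](lin_ext_basis (qsym (shifted_inv s N)) k) Ek lin_ext_sum.
rewrite horner_zeta_poly -sumrB; apply: eq_bigr => l _.
by rewrite qsymM qsym_pow1 qsym_one -/(v N) -/(v' N) -/(t l N) -/(z l); ring.
Qed.

(** Both sides are polynomials in T, compared at the points h_N, where they
agree up to a negligible error with the two sides of the exact relation
between truncations. *)
Lemma zeta_poly_shift s a k : is_index (a :: k) ->
  zeta_poly (a :: k) s =
    zeta_poly (a :: k) (s + 1) + ((1 + s) ^- a) *: zeta_poly k (s + 1).
Proof.
move=> idx; have idx_k : is_index k by case/andP: idx.
apply/eqP; rewrite -subr_eq0; apply/eqP; apply: small_poly_harmonic.
set p := zeta_poly _ s; set p1 := zeta_poly _ (s + 1); set p2 := zeta_poly k _.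
have S1 := small_zeta_poly s idx.
have S2 := small_zeta_poly (s + 1) idx.
have S3 := small_zeta_poly (s + 1) idx_k.
have {}S1 : small (fun N => qsym (shifted_inv s N.+1) (a :: k) - p.[(h N.+1)%:C]).
  move=> q; have [C HC] := S1 q; exists C => N; apply: le_trans (HC N.+1).
  rewrite ler_wpM2l ?normc_ge0 // lerXn2r ?nnegrE ?addr_ge0 ?harmonic_num_ge0 //.
  by rewrite lerD2l harmonic_num_nd.
apply: eq_small (smallD (smallD (smallN S1) (smallN (small_poly_harmonic_step p)))
  (smallD S2 (smallM (moderate_cst ((1 + s) ^- a)) S3))) => N.
rewrite shifted_inv_cons /= hornerD hornerN hornerD hornerZ exprVn -/p1 -/p2; ring.
Qed.

(** The regularized value with the parameter that occurs in multitangents. *)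
Definition zeta_star T k s : R[i] := zeta_reg (T - harmonicH s) k s.

Lemma zeta_star_nil T s : zeta_star T [::] s = 1.
Proof.
have : zeta_poly [::] s - 1 = 0.
  apply: small_poly_harmonic.
  apply: eq_small (smallN (small_zeta_poly s (isT : is_index [::]))) => N.
  by rewrite qsym_nil hornerD hornerN hornerC opprB.
by move/eqP; rewrite subr_eq0 /zeta_star -horner_zeta_poly => /eqP ->; rewrite hornerC.
Qed.

Lemma zeta_star_shift T s a k : is_index (a :: k) ->
  zeta_star T (a :: k) s =
    zeta_star T (a :: k) (s + 1) + (1 + s) ^- a * zeta_star T k (s + 1).
Proof.
by move=> idx; rewrite /zeta_star -!horner_zeta_poly zeta_poly_shift // hornerD hornerZ.
Qed.

(** * Periodicity *)

(** The second sum of the definition is the correction that moves the right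
factors of the first sum from s + 1 to s. *)
Lemma multitangent_succE T s k : is_index k ->
  multitangent_reg T k (s + 1) = \sum_(j < (size k).+1)
    (-1) ^+ sumn (take j k) * zeta_star T (rev (take j k)) (- (s + 1))
      * zeta_star T (drop j k) s.
Proof.
move=> idx; rewrite /multitangent_reg !big_ord_recr /= drop_size.
rewrite -!/(zeta_star _ _ _) !zeta_star_nil addrAC -big_split /=; congr (_ + _).
apply: eq_bigr => j _; rewrite -!/(zeta_star _ _ _).
have idx_j : is_index (drop j k) by apply/allP => a /mem_drop; apply/allP.
move: idx_j; rewrite (drop_nth 0%N) // => /(zeta_star_shift T s) ->.
by rewrite [1 + s]addrC; ring.
Qed.

(** Here the second sum moves the left factors from - s to - (s + 1). *)
Lemma multitangentE T s k : is_index k ->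
  multitangent_reg T k s = \sum_(j < (size k).+1)
    (-1) ^+ sumn (take j k) * zeta_star T (rev (take j k)) (- (s + 1))
      * zeta_star T (drop j k) s.
Proof.
move=> idx; rewrite /multitangent_reg !big_ord_recl /= take0 /rev /=.
rewrite -!/(zeta_star _ _ _) !zeta_star_nil -addrA -big_split /=; congr (_ + _).
apply: eq_bigr => j _; rewrite -!/(zeta_star _ _ _) -!/(rev _) /bump /= add1n.
have idx_j : is_index (rev (take j.+1 k)).
  by apply/allP => a; rewrite mem_rev => /mem_take; apply/allP.
move: idx_j; rewrite (take_nth 0%N) // rev_rcons => /(zeta_star_shift T (- (s + 1))) ->.
have -> : - (s + 1) + 1 = - s by ring.
have -> : 1 - (s + 1) = - s by ring.
rewrite sumn_rcons exprD; set a := nth _ _ _.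
have sgn : (-1) ^+ a * (- s) ^- a = s ^- a.
  by rewrite [(- s) ^+ a]exprNn invfM -exprVn invrN1 signrMK.
by rewrite -sgn; ring.
Qed.

End Asymptotics.

Theorem proposition3p6 (R : realType) (k : seq nat) (hk : is_index k)
    (T s : R[i]) (hs : forall m : int, s <> m%:~R) :
  multitangent_reg T k (s + 1) = multitangent_reg T k s.
Proof. by rewrite multitangent_succE // multitangentE. Qed.
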